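(* For any pair of finite simple graphs $X$ and $Y$, \[ \gamma (X\square Y\square P_2)\geq \frac{2}{3}\gamma (X)\gamma (Y). \]
   Context: $\gamma(G)$ denotes the domination number of a graph $G$ (the minimum size of a set $S\subseteq V(G)$ such that every vertex of $G$ is in $S$ or adjacent to a vertex of $S$). $X\square Y$ denotes the Cartesian product of graphs: vertex set $V(X)\times V(Y)$, with $(x_1,y_1)$ adjacent to $(x_2,y_2)$ iff either $x_1=x_2$ and $y_1y_2\in E(Y)$, or $y_1=y_2$ and $x_1x_2\in E(X)$. $P_n$ is the path graph on $n$ vertices. *)

(* Defs.v *)
From mathcomp Require Import all_boot all_order all_algebra.

Set Implicit Arguments.
Unset Strict Implicit.
Unset Printing Implicit Defensive.

(* The empty graph is allowed; its domination number is 0. *)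
Record sgraph := SGraph {
  vertex :> finType;
  edge : rel vertex;
  edge_sym : symmetric edge;
  edge_irrefl : irreflexive edge }.

Definition dominating (G : sgraph) (S : {set G}) : bool :=
  [forall v : G, (v \in S) || [exists u in S, edge v u]].

(* The default [set: G] of the arg min is dominating (dominating_setT), so this
   is the least cardinality of a dominating set. *)
Definition domination_number (G : sgraph) : nat :=
  #|[arg min_(S < [set: G] | dominating S) #|S|]|.

Lemma dominating_setT (G : sgraph) : dominating [set: G].
Proof. by apply/forallP => v; rewrite inE. Qed.

Section CartesianProduct.
Variables X Y : sgraph.

Definition cart_edge : rel (X * Y) := fun p q =>
  (p.1 == q.1) && edge p.2 q.2 || (p.2 == q.2) && edge p.1 q.1.

Lemma cart_edge_sym : symmetric cart_edge.
Proof.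
move=> p q; rewrite /cart_edge (eq_sym p.1) (eq_sym p.2).
by rewrite (edge_sym p.1) (edge_sym p.2).
Qed.

Lemma cart_edge_irrefl : irreflexive cart_edge.
Proof. by move=> p; rewrite /cart_edge !edge_irrefl !andbF. Qed.

Definition cart_prod : sgraph := SGraph cart_edge_sym cart_edge_irrefl.
End CartesianProduct.

Section PathGraph.
Variable n : nat.

Definition path_edge : rel 'I_n := fun i j =>
  (i.+1 == j :> nat) || (j.+1 == i :> nat).

Lemma path_edge_sym : symmetric path_edge.
Proof. by move=> i j; rewrite /path_edge orbC. Qed.

Lemma path_edge_irrefl : irreflexive path_edge.
Proof. by move=> i; rewrite /path_edge orbb -addn1 -[X in _ == X]addn0 eqn_add2l. Qed.

(* n is the number of vertices. *)
Definition path_graph : sgraph := SGraph path_edge_sym path_edge_irrefl.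
End PathGraph.

(* Main.v *)
(* Clark-Suen double counting. Fix a minimum dominating set A of X and assign
   every vertex x of X to a cell, named by some f x in A dominating x. Let D
   dominate X □ Y □ Z. For a in A, project the part of D over the cell of a
   onto Y: together with the set of those y that this projection leaves
   undominated, it dominates Y. If y is left undominated for a, then in every
   layer t of Z all points (x, y, t) with x in the cell of a are dominated only
   along X. Hence in the row (y, t) the points of D can replace in A all such a,
   and minimality of A bounds the number of such a by the size of D in that row,
   for each t. Summing over a, y and t gives
   |Z| γ(X) γ(Y) <= (|Z| + 1) |D|; the theorem is the case |Z| = 2. *)
Require Import Defs.
From mathcomp Require Import all_boot all_order all_algebra.
Import Order.TTheory GRing.Theory Num.Theory.
Local Open Scope ring_scope.

Lemma dominatingP (G : sgraph) (S : {set G}) :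
  reflect (forall v, exists2 u, u \in S & (v == u) || edge v u) (dominating S).
Proof.
apply: (iffP forallP) => domS v.
  case/orP: (domS v) => [vS | /existsP[u /andP[uS vu]]].
    by exists v; rewrite ?eqxx.
  by exists u; rewrite ?vu ?orbT.
have [u uS /orP[/eqP-> | vu]] := domS v; first by rewrite uS.
by apply/orP; right; apply/existsP; exists u; rewrite uS.
Qed.

Lemma domination_number_le (G : sgraph) (S : {set G}) :
  dominating S -> (domination_number G <= #|S|)%N.
Proof.
move=> domS; rewrite /domination_number.
by case: arg_minnP => [|T _]; [exact: dominating_setT | apply].
Qed.

Lemma domination_number_witness (G : sgraph) :
  exists2 S : {set G}, dominating S & #|S| = domination_number G.
Proof.
rewrite /domination_number.
by case: arg_minnP => [|T domT _]; [exact: dominating_setT | exists T].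
Qed.

Lemma sum_card_fibers (T I : finType) (f : T -> I) (D : {set T}) (A : {set I}) :
  (forall x, f x \in A) ->
  (\sum_(a in A) #|[set x in D | f x == a]| = #|D|)%N.
Proof.
move=> fA; rewrite -[RHS]sum1_card (partition_big f (mem A)) //=.
apply: eq_bigr => a _; rewrite -sum1_card.
by apply: eq_bigl => x; rewrite inE.
Qed.

Lemma exchange_sum_card (I J : finType) (A : {set I}) (Q : I -> {set J}) :
  (\sum_(a in A) #|Q a| = \sum_y #|[set a in A | y \in Q a]|)%N.
Proof.
under eq_bigr do rewrite -sum1_card big_mkcond.
rewrite exchange_big; apply: eq_bigr => y _.
rewrite -sum1_card -big_mkcondr.
by apply: eq_bigl => a; rewrite inE.
Qed.

Lemma domination_number_undominated (G : sgraph) (P : {set G}) :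
  (domination_number G
     <= #|P| + #|[set v | ~~ [exists u in P, (v == u) || edge v u]]|)%N.
Proof.
set Q := [set v | _].
apply: leq_trans (leq_card_setU P Q); apply: domination_number_le.
apply/dominatingP => v; have [vQ | ] := boolP (v \in Q).
  by exists v; rewrite ?eqxx // inE vQ orbT.
rewrite inE negbK => /existsP[u /andP[uP vu]].
by exists u; rewrite // inE uP.
Qed.

(** Exchanging [B] for [E] inside [A] keeps it dominating: [x] is dominated by [E] if [f x] lies in
    [B], and otherwise by [f x], which stays. As [A] is minimum, the exchange cannot shrink it. *)
Lemma card_replaceable (G : sgraph) (A B E : {set G}) (f : G -> G) :
  #|A| = domination_number G -> B \subset A -> (forall x, f x \in A) ->
  (forall x, (x == f x) || edge x (f x)) ->
  (forall x, f x \in B -> exists2 u, u \in E & (x == u) || edge x u) ->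
  (#|B| <= #|E|)%N.
Proof.
move=> cardA sBA fA fdom Edom.
have: (#|A| <= #|E :|: A :\: B|)%N.
  rewrite cardA; apply: domination_number_le; apply/dominatingP => x.
  have [/Edom[u uE xu] | fxB] := boolP (f x \in B).
    by exists u; rewrite // inE uE.
  by exists (f x); rewrite // !inE fxB fA orbT.
move/leq_trans/(_ (leq_card_setU _ _)).
by rewrite -(cardsID B A) (setIidPr sBA) leq_add2r.
Qed.

Theorem domination_number_cart_prod3 (X Y Z : sgraph) :
  (#|Z| * (domination_number X * domination_number Y)
     <= #|Z|.+1 * domination_number (cart_prod (cart_prod X Y) Z))%N.
Proof.
have [A /dominatingP domA cardA] := domination_number_witness X.
have [D /dominatingP domD <-] :=
  domination_number_witness (cart_prod (cart_prod X Y) Z).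
have /fin_all_exists[f fP] (x : X) :
    exists u : X, (u \in A) && ((x == u) || edge x u).
  by have [u uA xu] := domA x; exists u; rewrite uA.
have fA x : f x \in A by case/andP: (fP x).
have fdom x : (x == f x) || edge x (f x) by case/andP: (fP x).
pose F a := [set p in D | f p.1.1 == a].
pose P a : {set Y} := [set p.1.2 | p in F a].
pose Q a : {set Y} := [set y | ~~ [exists u in P a, (y == u) || edge y u]].
pose B y := [set a in A | y \in Q a].
pose R (yt : Y * Z) := [set p in D | (p.1.2, p.2) == yt].
have leBR y t : (#|B y| <= #|R (y, t)|)%N.
  (* The projection of the row to [X] is the set that replaces [B y]. *)
  apply: leq_trans (leq_imset_card (fun p => p.1.1) (R (y, t))).
  apply: (@card_replaceable _ A _ _ f) => //.
    by apply/subsetP => a; rewrite inE => /andP[].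
  move=> x; rewrite !inE fA /= => noP.
  have [[[x' y'] t'] pD] := domD ((x, y), t).
  have offcell : f x' = f x -> (y == y') || edge y y' -> False.
    move=> fx yy'; case/negP: noP; apply/existsP; exists y'; rewrite yy' andbT.
    by apply/imsetP; exists (x', y', t'); rewrite // inE pD /= fx.
  have onrow : y = y' -> t = t' -> x' \in [set p.1.1 | p in R (y, t)].
    by move=> ey et; apply/imsetP; exists (x', y', t'); rewrite // inE pD ey et /=.
  (* Equality, a [Z]-edge and a [Y]-edge all keep [x], hence its cell, so [offcell] excludes them.
     Only an [X]-edge remains, and it stays in the row [(y, t)]. *)
  rewrite /= /cart_edge /= /cart_edge /= !xpair_eqE -!andbA.
  case/orP => [/and3P[/eqP ex ey _] | ].
    by case: offcell; rewrite ?ex ?ey.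
  case/orP => [/and3P[/eqP ex ey _] | /andP[/eqP et]].
    by case: offcell; rewrite ?ex ?ey.
  case/orP => /andP[/eqP e xy].
    by case: offcell; rewrite ?e ?xy ?orbT.
  by exists x'; rewrite ?onrow // xy orbT.
have leQD : (#|Z| * \sum_(a in A) #|Q a| <= #|D|)%N.
  have <- : (\sum_yt #|R yt| = #|D|)%N.
    rewrite -(sum_card_fibers _ _ (fun p : (X * Y) * Z => (p.1.2, p.2)) D setT) //.
    by apply: eq_bigl => yt; rewrite inE.
  (* Counting the pairs [(a, y)] by [y] turns the sum into that of [#|B y|]; the factor [#|Z|] gives
     each layer [t] its own copy of [#|B y|], to be compared with the row [(y, t)]. *)
  rewrite exchange_sum_card big_distrr /=.
  rewrite -(pair_bigA _ (fun y t => #|R (y, t)|)) /=.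
  apply: leq_sum => y _; rewrite -sum_nat_const (eq_bigl xpredT) //.
  by apply: leq_sum => t _; exact: leBR.
have leYPQ a : (domination_number Y <= #|F a| + #|Q a|)%N.
  apply: leq_trans (domination_number_undominated _ (P a)) _.
  by rewrite leq_add2r leq_imset_card.
have lePD : (domination_number X * domination_number Y
    <= #|D| + \sum_(a in A) #|Q a|)%N.
  rewrite -cardA -sum_nat_const.
  rewrite -(sum_card_fibers _ _ (fun p : (X * Y) * Z => f p.1.1) D A) //.
  by rewrite -big_split; apply: leq_sum => a _; exact: leYPQ.
(* After scaling [lePD] by [#|Z|], [leQD] absorbs the undominated part into a single extra
   [#|D|]. *)
apply: leq_trans (leq_mul (leqnn _) lePD) _.
by rewrite mulnDr mulSn addnC leq_add2r.
Qed.

Theorem theorem2 (X Y : sgraph) :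
  2%:R / 3%:R * (domination_number X)%:R * (domination_number Y)%:R
  <= (domination_number (cart_prod (cart_prod X Y) (path_graph 2)))%:R :> rat.
Proof.
have := domination_number_cart_prod3 X Y (path_graph 2).
rewrite card_ord -(ler_nat rat) !natrM => le23.
by rewrite -2!mulrA mulrCA ler_pdivrMl.
Qed.
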